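(* Let $\ell$ be a positive integer. Two pairs of vectors $(\mathbf{u},\mathbf{v}),(\mathbf{u}',\mathbf{v}')\in\mathbb{C}^{\mathbb{Z}_\ell}\times\mathbb{C}^{\mathbb{Z}_\ell}$ are equivalent if they are in the same orbit under the action of $GG$. Hence, equivalence of pairs is an equivalence relation on $\mathbb{C}^{\mathbb{Z}_\ell}\times\mathbb{C}^{\mathbb{Z}_\ell}$.
   Context: $\mathbb{Z}_\ell$ is the ring of integers modulo $\ell$, $\mathbb{Z}_\ell^\times$ its multiplicative group of units, and $\mathbb{C}^{\mathbb{Z}_\ell}$ the set of complex vectors indexed by $\mathbb{Z}_\ell$. For $j\in\mathbb{Z}_\ell$, the cyclic shift $c_j$ on $\mathbb{C}^{\mathbb{Z}_\ell}$ is $(c_j(\mathbf{v}))_i=v_{i-j}$. For $k\in\mathbb{Z}_\ell^\times$, the decimation $d_k$ on $\mathbb{C}^{\mathbb{Z}_\ell}$ is $(d_k(\mathbf{v}))_i=v_{ik^{-1}}$. The switch is $s(\mathbf{u},\mathbf{v})=(\mathbf{v},\mathbf{u})$. Definition of equivalent: $(\mathbf{u},\mathbf{v})$ and $(\mathbf{u}',\mathbf{v}')$ are equivalent if $$(\mathbf{u}',\mathbf{v}')=s^f\big(d_k(c_i(\mathbf{u})),d_k(c_j(\mathbf{v}))\big)\quad\text{or}\quad(\mathbf{u}',\mathbf{v}')=s^f\big(d_k(c_i(\mathbf{u})),d_{-k}(c_j(\mathbf{v}))\big)$$ for some $k\in\mathbb{Z}_\ell^\times$, $i,j\in\mathbb{Z}_\ell$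 and $f\in\{0,1\}$. $GG$ is the group, under function composition, generated by the following maps from $\mathbb{C}^{\mathbb{Z}_\ell}\times\mathbb{C}^{\mathbb{Z}_\ell}$ to itself: $(\mathbf{u},\mathbf{v})\mapsto(c_i(\mathbf{u}),c_j(\mathbf{v}))$ for $i,j\in\mathbb{Z}_\ell$; $(\mathbf{u},\mathbf{v})\mapsto(d_k(\mathbf{u}),d_{(-1)^rk}(\mathbf{v}))$ for $k\in\mathbb{Z}_\ell^\times$, $r\in\{0,1\}$; and $s$. It acts on $\mathbb{C}^{\mathbb{Z}_\ell}\times\mathbb{C}^{\mathbb{Z}_\ell}$ by evaluation. *)

(* Defs.v *)
From mathcomp Require Import all_boot all_order all_algebra complex.
From mathcomp Require Import boolp classical_sets reals.
From Corelib Require Export RelationClasses.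

Set Implicit Arguments.
Unset Strict Implicit.
Unset Printing Implicit Defensive.

Local Open Scope classical_set_scope.

(** Z_l is represented by 'I_l with the operations Zp_add, Zp_opp, Zp_mul and
    Zp_inv of zmodp, which are defined for every modulus, including l = 1. *)

Definition Zunits (l : nat) : set 'I_l :=
  [set k | exists k' : 'I_l, k * k' = 1 %[mod l]].

Definition cvec (R : realType) (l : nat) := {ffun 'I_l -> R[i]}.

Definition cpair (R : realType) (l : nat) := (cvec R l * cvec R l)%type.

Section Maps.
Variables (R : realType) (l : nat).
Implicit Types (u v : cvec R l) (p q : cpair R l).

Definition shift (j : 'I_l) v : cvec R l :=
  [ffun i => v (Zp_add i (Zp_opp j))].

(* Zp_inv k is the inverse of k only when k is a unit; every use of
   [decimate k] below is guarded by [Zunits k]. *)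
Definition decimate (k : 'I_l) v : cvec R l :=
  [ffun i => v (Zp_mul i (Zp_inv k))].

Definition switch p : cpair R l := (p.2, p.1).

Definition equivalent p q : Prop :=
  exists (k i j : 'I_l) (f : bool), Zunits k /\
    (q = iter f switch (decimate k (shift i p.1), decimate k (shift j p.2)) \/
     q = iter f switch
           (decimate k (shift i p.1), decimate (Zp_opp k) (shift j p.2))).

Definition shift_pair (i j : 'I_l) p : cpair R l :=
  (shift i p.1, shift j p.2).

(* [iter r (@Zp_opp l) k] is (-1)^r k. *)
Definition decimate_pair (k : 'I_l) (r : bool) p : cpair R l :=
  (decimate k p.1, decimate (iter r (@Zp_opp l) k) p.2).

Definition GG_generators : set (cpair R l -> cpair R l) :=
  [set g | (exists i j, g = shift_pair i j)
        \/ (exists k r, Zunits k /\ g = decimate_pair k r)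
        \/ g = switch].

End Maps.

Definition composition_group (T : Type) (G : set (T -> T)) : Prop :=
  [/\ G id,
      forall f g, G f -> G g -> G (f \o g)
    & forall f, G f -> exists2 g, G g & cancel f g /\ cancel g f].

Definition GG (R : realType) (l : nat) : set (cpair R l -> cpair R l) :=
  smallest (@composition_group (cpair R l)) (@GG_generators R l).

Definition same_orbit (T : Type) (G : set (T -> T)) (x y : T) : Prop :=
  exists z, [set g z | g in G] x /\ [set g z | g in G] y.

Lemma ZunitsP (l : nat) (k : 'I_l) : Zunits k <-> coprime l k.
Proof.
case: l k => [[]//|l] k; split=> [[k' kk']|co_lk].
  apply: (@Zp_intro_unit l k k'); apply: val_inj => /=.
  by rewrite mulnC kk'.
by exists (Zp_inv k); have /(congr1 val) := Zp_mulzV co_lk.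
Qed.

Lemma Zunits_opp (l : nat) (k : 'I_l) : Zunits k -> Zunits (Zp_opp k).
Proof.
move=> /ZunitsP co_lk; apply/ZunitsP; rewrite coprime_modr.
move: (nat_of_ord k) (ltnW (ltn_ord k)) co_lk => n le_nl.
rewrite -{1 2}(subnK le_nl); move: (l - n) => x.
by rewrite coprime_sym /coprime gcdnDr gcdnC [gcdn _ x]gcdnC gcdnDl.
Qed.

Lemma shift_bij (R : realType) (l : nat) (j : 'I_l) :
  bijective (@shift R l j).
Proof.
case: l j => [[]//|l] j; exists (shift (Zp_opp j)) => v; apply/ffunP => i;
  rewrite !ffunE; congr (v _).
  exact: (GRing.addrNK (- j)%R i).
exact: (GRing.addrK (- j)%R i).
Qed.

Lemma decimate_bij (R : realType) (l : nat) (k : 'I_l) :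
  Zunits k -> bijective (@decimate R l k).
Proof.
case: l k => [[]//|l] k /ZunitsP co_lk.
exists (fun v : cvec R l.+1 => [ffun i => v (Zp_mul i k)]) => v; apply/ffunP => i;
  rewrite !ffunE; congr (v _); rewrite -Zp_mulA.
  by rewrite Zp_mulzV // Zp_mulC Zp_mul1z.
by rewrite Zp_mulVz // Zp_mulC Zp_mul1z.
Qed.

Lemma GG_generators_bij (R : realType) (l : nat) g :
  GG_generators g -> bijective (g : cpair R l -> cpair R l).
Proof.
have pair_bij (g1 g2 : cvec R l -> cvec R l) :
    bijective g1 -> bijective g2 ->
    bijective (fun p : cpair R l => (g1 p.1, g2 p.2)).
  move=> [h1 g1K h1K] [h2 g2K h2K].
  exists (fun p => (h1 p.1, h2 p.2)) => -[x y] /=.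
    by rewrite g1K g2K.
  by rewrite h1K h2K.
case=> [[i [j ->]]|[[k [r [Uk ->]]]|->]].
- by apply: pair_bij; apply: shift_bij.
- apply: pair_bij; apply: decimate_bij => //.
  by case: r => //=; apply: Zunits_opp.
- by exists (@switch R l) => -[].
Qed.

(* [smallest] is an intersection, hence everything if taken over an empty
   family; here the family contains the group of all bijections. *)
Lemma GG_group (R : realType) (l : nat) :
  composition_group (@GG R l) /\ (forall g, @GG R l g -> bijective g).
Proof.
have bijG : composition_group [set g : cpair R l -> cpair R l | bijective g].
  split.
  - by exists id.
  - by move=> f g bf bg; apply: bij_comp.
  - by move=> f [g fK gK]; exists g => //; exists f.
have GGbij g : @GG R l g -> bijective g.
  by move=> GGg; apply: (GGg _ (conj bijG (@GG_generators_bij R l))).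
split=> //; split.
- by move=> G [[]].
- by move=> f g GGf GGg G GP; case: (GP) => -[_ compG _] _;
    apply: compG; [apply: GGf|apply: GGg].
- move=> f GGf; have [g fK gK] := GGbij f GGf; exists g => //.
  move=> G GP; case: (GP) => -[_ _ invG] _.
  have [h Gh [fKh hKf]] := invG f (GGf G GP).
  suff -> : g = h by [].
  by apply/funext => x; rewrite -[LHS]fKh gK.
Qed.

(* Main.v *)
Require Import Defs.
From mathcomp Require Import all_boot all_order all_algebra complex.
From mathcomp Require Import boolp classical_sets reals.

Set Implicit Arguments.
Unset Strict Implicit.
Unset Printing Implicit Defensive.

(** The pairs equivalent to [p] are the images of [p] under the maps
    [s^f o (d_k, d_(+-k)) o (c_i, c_j)].  Each such map is a composite of
    generators of [GG], so equivalent pairs share an orbit.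

    Conversely, applying one more generator to such an image gives an image of
    the same shape, because a generator can be moved to its place in the
    composite: [c_i o d_k = d_k o c_(i / k)], [d_k' o d_k = d_(k' k)], and [s]
    exchanges the two coordinates, where [d_k] and [d_(+-k)] play symmetric
    roles since [k = +-(+-k)].  This is [equivalent_generator].  As the inverse
    of a generator is again a generator, the class of [p] is invariant under
    every generator in both directions; the bijections that leave all classes
    invariant form a group, which therefore contains [GG]
    ([equivalent_GG]).  Since [p] is equivalent to itself, its class contains
    its whole orbit.

    Being in the same orbit of a group is an equivalence relation, whence the
    last assertion. *)

(** * Arithmetic of integers modulo l *)

Section ZpArithmetic.
Variable l : nat.
Implicit Types a b k : 'I_l.+1.

Lemma Zunits_mul a b : Zunits a -> Zunits b -> Zunits (Zp_mul a b).
Proof.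
move=> /ZunitsP co_a /ZunitsP co_b; apply/ZunitsP.
by rewrite coprime_modr coprimeMr co_a.
Qed.

Lemma Zp_mulN a b : Zp_mul a (Zp_opp b) = Zp_opp (Zp_mul a b).
Proof.
case: l a b => [|n] a b; first by rewrite [LHS]ord1 [RHS]ord1.
exact: (GRing.mulrN (a : 'Z_n.+2) b).
Qed.

Lemma Zp_oppK : involutive (@Zp_opp l.+1).
Proof. exact: (@GRing.opprK 'I_l.+1). Qed.

Lemma Zp_inv_uniq a b : Zunits a -> Zp_mul a b = Zp1 -> Zp_inv a = b.
Proof.
move=> /ZunitsP co_a ab1.
by rewrite -[RHS]Zp_mul1z -(Zp_mulVz co_a) -Zp_mulA ab1 Zp_mulC Zp_mul1z.
Qed.

Lemma Zunits1 : Zunits (Zp1 : 'I_l.+1).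
Proof. by apply/ZunitsP; rewrite /= coprime_modr coprimen1. Qed.

Lemma Zp_inv1 : Zp_inv Zp1 = Zp1 :> 'I_l.+1.
Proof. exact: Zp_inv_uniq Zunits1 (Zp_mul1z _). Qed.

Lemma Zunits_inv a : Zunits a -> Zunits (Zp_inv a).
Proof.
by move=> /ZunitsP/Zp_mulVz/(congr1 val) /= aV1; exists a; rewrite aV1.
Qed.

Lemma Zp_invM a b : Zunits a -> Zunits b ->
  Zp_inv (Zp_mul a b) = Zp_mul (Zp_inv a) (Zp_inv b).
Proof.
move=> Ua Ub; apply: Zp_inv_uniq; first exact: Zunits_mul.
have /ZunitsP co_a := Ua; have /ZunitsP co_b := Ub.
rewrite [Zp_mul a b]Zp_mulC -Zp_mulA (Zp_mulA a) Zp_mulzV // Zp_mul1z.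
exact: Zp_mulzV.
Qed.

Lemma Zunits_signed (r : bool) k : Zunits k -> Zunits (iter r (@Zp_opp _) k).
Proof. by case: r => //; apply: Zunits_opp. Qed.

Lemma Zp_mul_signed (r s : bool) a b :
  Zp_mul (iter r (@Zp_opp _) a) (iter s (@Zp_opp _) b) =
  iter (r (+) s) (@Zp_opp _) (Zp_mul a b).
Proof.
have mulNz x y : Zp_mul (Zp_opp x) y = Zp_opp (Zp_mul x y) :> 'I_l.+1.
  by rewrite Zp_mulC Zp_mulN Zp_mulC.
by case: r s => [] [] //=; rewrite ?mulNz ?Zp_mulN ?Zp_oppK.
Qed.

End ZpArithmetic.

(** * Relations between the generators *)

Section Relations.
Variables (R : realType) (l : nat).
Implicit Types (k i j : 'I_l.+1) (r f : bool).
Implicit Types (v : cvec R l.+1) (p q : cpair R l.+1).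

Lemma shift_add i j v : shift i (shift j v) = shift (Zp_add i j) v.
Proof.
apply/ffunP => x; rewrite !ffunE; congr (v _).
rewrite -[LHS]/(x - i - j)%R -[RHS]/(x - (i + j))%R.
by rewrite GRing.opprD GRing.addrA.
Qed.

Lemma shift0 v : shift (Zp0 : 'I_l.+1) v = v.
Proof.
by apply/ffunP => x; rewrite ffunE; congr (v _); apply: (GRing.subr0 x).
Qed.

Lemma decimate1 v : decimate (Zp1 : 'I_l.+1) v = v.
Proof.
by apply/ffunP => x; rewrite ffunE Zp_inv1; congr (v _); rewrite Zp_mulC Zp_mul1z.
Qed.

Lemma decimate_mul k k' v : Zunits k -> Zunits k' ->
  decimate k (decimate k' v) = decimate (Zp_mul k k') v.
Proof.
move=> Uk Uk'; apply/ffunP => x; rewrite !ffunE; congr (v _).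
by rewrite Zp_invM // Zp_mulA.
Qed.

Lemma shift_decimate i k v :
  shift i (decimate k v) = decimate k (shift (Zp_mul i (Zp_inv k)) v).
Proof.
apply/ffunP => x; rewrite !ffunE; congr (v _).
by rewrite Zp_mul_addl; congr Zp_add; rewrite Zp_mulC Zp_mulN Zp_mulC.
Qed.

Lemma switchK : involutive (@switch R l.+1).
Proof. by case. Qed.

Lemma shift_pair_switch i j p :
  shift_pair i j (switch p) = switch (shift_pair j i p).
Proof. by []. Qed.

Lemma shift_pair_add i j i' j' p :
  shift_pair i j (shift_pair i' j' p) =
  shift_pair (Zp_add i i') (Zp_add j j') p.
Proof. by rewrite /shift_pair !shift_add. Qed.

Lemma shift_pair0 p : shift_pair Zp0 Zp0 p = p.
Proof. by case: p => u v; rewrite /shift_pair !shift0. Qed.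

Lemma shift_pairK i j :
  cancel (@shift_pair R _ (Zp_opp i) (Zp_opp j)) (shift_pair i j).
Proof.
by move=> p; rewrite shift_pair_add ![Zp_add _ (Zp_opp _)]Zp_addC !Zp_addNz
  shift_pair0.
Qed.

(** The coordinates are decimated by [k] and [+-k]; after the switch the first
    one carries [+-k], and the second one [k = +-(+-k)], with the same sign. *)
Lemma decimate_pair_switch k r p :
  decimate_pair k r (switch p) =
  switch (decimate_pair (iter r (@Zp_opp _) k) r p).
Proof. by case: r; rewrite /decimate_pair /switch /= ?Zp_oppK. Qed.

Lemma decimate_pair_mul k r k' r' p : Zunits k -> Zunits k' ->
  decimate_pair k r (decimate_pair k' r' p) =
  decimate_pair (Zp_mul k k') (r (+) r') p.
Proof.
move=> Uk Uk'; rewrite /decimate_pair -Zp_mul_signed.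
by rewrite !decimate_mul //; apply: Zunits_signed.
Qed.

Lemma decimate_pair1 p : decimate_pair Zp1 false p = p.
Proof. by case: p => u v; rewrite /decimate_pair !decimate1. Qed.

Lemma decimate_pairK k r : Zunits k ->
  cancel (@decimate_pair R _ (Zp_inv k) r) (decimate_pair k r).
Proof.
move=> Uk p; rewrite decimate_pair_mul ?addbb //; last exact: Zunits_inv.
by have /ZunitsP/Zp_mulzV-> := Uk; apply: decimate_pair1.
Qed.

Lemma shift_decimate_pair i j k r p :
  shift_pair i j (decimate_pair k r p) =
  decimate_pair k r (shift_pair (Zp_mul i (Zp_inv k))
    (Zp_mul j (Zp_inv (iter r (@Zp_opp _) k))) p).
Proof. by rewrite /shift_pair /decimate_pair !shift_decimate. Qed.

(** * Equivalence classes and orbits *)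

(** The two alternatives of the definition are the two values of the sign [r],
    so that a single normal form describes all equivalent pairs. *)
Lemma equivalentP p q :
  equivalent p q <-> exists k r i j f, Zunits k /\
    q = iter f (@switch R _) (decimate_pair k r (shift_pair i j p)).
Proof.
split=> [[k [i [j [f [Uk [->|->]]]]]]|[k [[] [i [j [f [Uk ->]]]]]]].
- by exists k, false, i, j, f.
- by exists k, true, i, j, f.
- by exists k, i, j, f; split=> //; right.
- by exists k, i, j, f; split=> //; left.
Qed.

Lemma equivalent_refl p : equivalent p p.
Proof.
apply/equivalentP; exists Zp1, false, Zp0, Zp0, false.
by rewrite /= shift_pair0 decimate_pair1; split=> //; apply: Zunits1.
Qed.

(** The maps in normal form are stable under composition with a generator on
    the left: the generator is moved past the switch, then merged with the
    decimation or moved past it and merged with the shift. *)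
Lemma equivalent_generator g p q :
  GG_generators g -> equivalent p q -> equivalent p (g q).
Proof.
move=> Gg /equivalentP[k [r [i [j [f [Uk ->]]]]]]; apply/equivalentP.
case: Gg => [[i' [j' ->]]|[[k' [r' [Uk' ->]]]|->]].
- case: f => /=; rewrite ?shift_pair_switch shift_decimate_pair shift_pair_add.
    by do 4!eexists; exists true; split; first exact: Uk.
  by do 4!eexists; exists false; split; first exact: Uk.
- case: f => /=; rewrite ?decimate_pair_switch decimate_pair_mul //.
  + do 4!eexists; exists true; split; last by [].
    by apply: Zunits_mul Uk; apply: Zunits_signed.
  + exact: Zunits_signed.
  + do 4!eexists; exists false; split; last by [].
    exact: Zunits_mul.
- by exists k, r, i, j, (~~ f); case: f; rewrite /= ?switchK.
Qed.

Lemma GG_generators_inv g : GG_generators g ->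
  exists2 h, GG_generators h & cancel (h : cpair R l.+1 -> _) g.
Proof.
case=> [[i [j ->]]|[[k [r [Uk ->]]]|->]].
- exists (shift_pair (Zp_opp i) (Zp_opp j)); last exact: shift_pairK.
  by left; exists (Zp_opp i), (Zp_opp j).
- exists (decimate_pair (Zp_inv k) r); last exact: decimate_pairK.
  by right; left; exists (Zp_inv k), r; split=> //; apply: Zunits_inv.
- by exists (@switch R _); [right; right|apply: switchK].
Qed.

(** Stated as an equivalence, invariance of the classes passes to inverses, so
    it holds on the whole generated group once it holds for generators. *)
Lemma equivalent_GG g p q : GG g -> equivalent p (g q) <-> equivalent p q.
Proof.
move=> GGg.
pose S (g : cpair R l.+1 -> cpair R l.+1) :=
  bijective g /\ forall p q, equivalent p (g q) <-> equivalent p q.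
suff [_ +] : S g by apply.
apply: (GGg S); split; first split.
- by split; first exists id.
- move=> g1 g2 [bij1 eq1] [bij2 eq2]; split; first exact: bij_comp.
  by move=> p' q' /=; split=> [/eq1/eq2|/eq2/eq1].
- move=> g1 [[h g1K hK] eq1]; exists h => //; split; first by exists g1.
  by move=> p' q'; split=> [/eq1|E]; [|apply/eq1]; rewrite hK.
move=> g1 Gg1; split; first exact: GG_generators_bij Gg1.
move=> p' q'; split; last exact: equivalent_generator.
have [h Gh hK] := GG_generators_inv Gg1.
have hK' := bij_can_sym (GG_generators_bij Gg1) h.
by move=> /(equivalent_generator Gh); move/hK': hK => ->.
Qed.

Lemma GG_generator (g : cpair R l.+1 -> cpair R l.+1) :
  GG_generators g -> GG g.
Proof. by move=> Gg G [_]; apply. Qed.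

Lemma equivalent_same_orbit p q : equivalent p q <-> same_orbit (@GG R _) p q.
Proof.
have [[GG1 GGM _] _] := GG_group R l.+1; split.
  move=> /equivalentP[k [r [i [j [f [Uk ->]]]]]]; exists p.
  split; first by exists id.
  have GGs : GG (iter f (@switch R l.+1)).
    by case: f => //; apply: GG_generator; right; right.
  have GGd : GG (@decimate_pair R l.+1 k r).
    by apply: GG_generator; right; left; exists k, r.
  have GGc : GG (@shift_pair R l.+1 i j).
    by apply: GG_generator; left; exists i, j.
  exists (iter f (@switch R _) \o (decimate_pair k r \o shift_pair i j)) => //.
  exact: GGM _ _ GGs (GGM _ _ GGd GGc).
case=> z [[g GGg <-] [h GGh <-]].
apply/(equivalent_GG _ _ GGh)/(equivalent_GG _ _ GGg).
exact: equivalent_refl.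
Qed.

End Relations.

Lemma same_orbit_sym (T : Type) (G : set (T -> T)) x y :
  same_orbit G x y -> same_orbit G y x.
Proof. by case=> z [Gx Gy]; exists z. Qed.

Theorem proposition2p10 (R : realType) (l : nat) (l_gt0 : 0 < l) :
  (forall u v u' v' : cvec R l,
     equivalent (u, v) (u', v') <-> same_orbit (@GG R l) (u, v) (u', v'))
  /\ Equivalence (@equivalent R l).
Proof.
case: l l_gt0 => // l _; split=> [u v u' v'|]; first exact: equivalent_same_orbit.
split=> [p|p q|p q t].
- exact: equivalent_refl.
- by move=> /equivalent_same_orbit pq; apply/equivalent_same_orbit/same_orbit_sym.
- (* [t] is the image of [q] under two successive elements of the group, and
     the class of [p] is invariant under both. *)
  move=> pq /equivalent_same_orbit[z [[g GGg gz] [h GGh <-]]].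
  by apply/(equivalent_GG _ _ GGh)/(equivalent_GG _ _ GGg); rewrite gz.
Qed.
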